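(* Let $\Omega$ be an eventually outward quiver with underlying graph $A_{\infty,\infty}$. There is an order-embedding $\iota$ (i.e. an order-preserving, injective and order-reflecting map) of the poset $\mathcal{C}$ of connected full subquivers of $\Omega$ with the reduction/enhancement partial order into the poset $(\Omega_1\cup\{-\infty\},<_L)\times(\Omega_1\cup\{\infty\},<_R)$, given by sending a connected subquiver $\alpha$ to the ordered pair consisting of its left and right literal or virtual boundary arrows respectively.
   Context: $\Omega$ is a quiver with vertex set $\Omega_0=\mathbb{Z}$ and arrow set $\Omega_1$ consisting of exactly one arrow, in one of the two directions, between each pair of consecutive integers ($A_{\infty,\infty}$); $s(e)$ and $t(e)$ are the source and target of $e$. It is eventually outward: all but finitely many arrows to the right of $0$ point right, and all but finitely many arrows to the left of $0$ point left. Removing an arrow $e$ splits $\Omega$ into the part in front of $e$ (containing $t(e)$) and the part behind $e$ (containing $s(e)$). $\mathcal{C}$ is the set of (nonempty) connected full subquivers. $\beta$ is a reduction of $\alpha$ if there is an arrow $e$ in $\alpha$ such that $\beta$ is the portion of $\alpha$ behind $e$; $\beta$ is an enhancement of $\alpha$ if there is an arrow $e$ in $\beta$ such that $\alpha$ is the portion of $\beta$ in front of $e$. The reduction/enhancement order is: $\alpha>\beta$ if $\beta$ is obtained from $\alpha$ by a finite sequence of one or more such moves. The left (literal) boundary arrow of $\alpha$ is the arrow joining the leftmost vertex of $\alpha$ to the vertex on its left, if $\alpha$ is bounded on the left; otherwise $\alpha$ has the left virtual arrow of $\Omega$ as left boundary, represented by the symbol $-\infty$. Similarly the right boundary is the arrow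 joining the rightmost vertex of $\alpha$ to the vertex on its right, or the right virtual arrow, represented by the symbol $\infty$, if $\alpha$ is unbounded on the right. The total orders $<_L$ on $\Omega_1\cup\{-\infty\}$ and $<_R$ on $\Omega_1\cup\{\infty\}$ are: if $e,e'$ are oriented the same way, then $e<_L e'$ and $e<_R e'$ if $e$ is behind $e'$; if $e$ points left and $e'$ points right then $e<_L-\infty<_L e'$ and $e'<_R\infty<_R e$. (Thus $-\infty$ lies above all left-pointing and below all right-pointing arrows for $<_L$, and $\infty$ lies above all right-pointing and below all left-pointing arrows for $<_R$.) The product of posets is ordered componentwise: $(p,q)\le(p',q')$ iff $p\le p'$ and $q\le q'$. *)

(* Defs.v *)
From Stdlib Require Import Relations.
From HB Require Import structures.
From mathcomp Require Import all_boot all_order all_algebra.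
From mathcomp Require Import boolp classical_sets functions cardinality.

Set Implicit Arguments.
Unset Strict Implicit.
Unset Printing Implicit Defensive.

Import Order.TTheory GRing.Theory Num.Theory.

Local Open Scope classical_set_scope.
Local Open Scope ring_scope.

Definition vertex := int.

(** The arrow [e] is the unique arrow joining the vertices [e] and [e + 1]. *)
Definition arrow := int.

(** A quiver with underlying graph A_{oo,oo} is an orientation of every arrow:
    [w e] is [true] when the arrow points right, i.e. goes from [e] to
    [e + 1], and [false] when it goes from [e + 1] to [e]. *)
Definition quiver := arrow -> bool.

Definition src (w : quiver) (e : arrow) : vertex := if w e then e else e + 1.
Definition tgt (w : quiver) (e : arrow) : vertex := if w e then e + 1 else e.

(** The arrows to the right of the vertex 0 are the [e >= 0], those to its left
    are the [e < 0]. *)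
Definition eventually_outward (w : quiver) : Prop :=
  finite_set [set e : arrow | 0 <= e /\ w e = false] /\
  finite_set [set e : arrow | e < 0 /\ w e = true].

(** Being joined by an undirected walk using only arrows of [E]. *)
Definition adjacent (w : quiver) (E : set arrow) (x y : vertex) : Prop :=
  exists2 e, E e &
    (src w e = x /\ tgt w e = y) \/ (src w e = y /\ tgt w e = x).
Definition linked (w : quiver) (E : set arrow) : vertex -> vertex -> Prop :=
  clos_refl_trans vertex (adjacent w E).

(** A full subquiver is given by its vertex set [A]. *)
Definition arrows_of (w : quiver) (A : set vertex) : set arrow :=
  [set e | A (src w e) /\ A (tgt w e)].

Definition connected_full (w : quiver) (A : set vertex) : Prop :=
  A !=set0 /\ forall x y, A x -> A y -> linked w (arrows_of w A) x y.

Record connsub (w : quiver) := ConnSub {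
  verts : set vertex;
  connsubP : connected_full w verts
}.

Definition behind (w : quiver) (e : arrow) : set vertex :=
  [set x | linked w (~` [set e]) (src w e) x].
Definition in_front (w : quiver) (e : arrow) : set vertex :=
  [set x | linked w (~` [set e]) (tgt w e) x].

Definition is_reduction (w : quiver) (alpha beta : connsub w) : Prop :=
  exists2 e, arrows_of w (verts alpha) e & verts beta = verts alpha `&` behind w e.

Definition is_enhancement (w : quiver) (alpha beta : connsub w) : Prop :=
  exists2 e, arrows_of w (verts beta) e & verts alpha = verts beta `&` in_front w e.

Definition move (w : quiver) (alpha beta : connsub w) : Prop :=
  is_reduction alpha beta \/ is_enhancement alpha beta.

(** Moves go downwards: [re_gt alpha beta] is alpha > beta. *)
Definition re_gt (w : quiver) : connsub w -> connsub w -> Prop :=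
  clos_trans (connsub w) (@move w).
Definition re_le (w : quiver) (alpha beta : connsub w) : Prop :=
  alpha = beta \/ re_gt beta alpha.

(** [Some e] is the literal arrow [e]; [None] is the virtual arrow, that is
    -oo for left boundaries and +oo for right boundaries. *)
Definition boundary := option arrow.

Definition left_boundary (w : quiver) (alpha : connsub w) (b : boundary) :
    Prop :=
  match b with
  | Some e => exists m : vertex,
      [/\ verts alpha m, forall x, verts alpha x -> m <= x & e = m - 1]
  | None => ~ exists m : vertex, forall x, verts alpha x -> m <= x
  end.

Definition right_boundary (w : quiver) (alpha : connsub w) (b : boundary) :
    Prop :=
  match b with
  | Some e => exists m : vertex,
      [/\ verts alpha m, forall x, verts alpha x -> x <= m & e = m]
  | None => ~ exists m : vertex, forall x, verts alpha x -> x <= m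
  end.

Definition arrow_behind (w : quiver) (e e' : arrow) : Prop :=
  arrows_of w (behind w e') e.

Definition ltL (w : quiver) (b b' : boundary) : Prop :=
  match b, b' with
  | Some e, Some e' =>
      (w e = w e' /\ arrow_behind w e e') \/ (w e = false /\ w e' = true)
  | Some e, None => w e = false
  | None, Some e' => w e' = true
  | None, None => False
  end.

Definition ltR (w : quiver) (b b' : boundary) : Prop :=
  match b, b' with
  | Some e, Some e' =>
      (w e = w e' /\ arrow_behind w e e') \/ (w e = true /\ w e' = false)
  | Some e, None => w e = true
  | None, Some e' => w e' = false
  | None, None => False
  end.

Definition leL (w : quiver) (b b' : boundary) : Prop := b = b' \/ ltL w b b'.
Definition leR (w : quiver) (b b' : boundary) : Prop := b = b' \/ ltR w b b'.

Definition leLR (w : quiver) (p p' : boundary * boundary) : Prop :=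
  leL w p.1 p'.1 /\ leR w p.2 p'.2.

Definition order_embedding (T U : Type) (leT : T -> T -> Prop)
    (leU : U -> U -> Prop) (f : T -> U) : Prop :=
  [/\ forall x y, leT x y -> leU (f x) (f y),
      injective f
    & forall x y, leU (f x) (f y) -> leT x y].

(* Main.v *)
Require Import Defs.
From mathcomp Require Import all_boot all_order all_algebra.
From mathcomp Require Import boolp classical_sets functions cardinality.
From Stdlib Require Import Relations.
From mathcomp Require Import zify.

(** A connected full subquiver is an integer interval, so it is determined by
    its pair [(l, r)] of boundary arrows ([boundariesP]).  Let [e] be an arrow
    inside such an interval.  The part behind [e] and the part in front of [e]
    each have [e] as one boundary and share the other boundary with [(l, r)];
    which one is shared depends on the direction of [e].  So every move changes
    exactly one boundary, and it lowers it for [<_L] or [<_R].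

    The two orders are made so that conversely every lowering of a single
    boundary is one move ([moveP]).  If the interval shrinks, then the new
    boundary arrow points out of the part that is kept, which is thus the part
    behind it, and the move is a reduction.  If the interval grows, then the old
    boundary arrow points into the smaller interval, which is thus the part in
    front of it, and the move is an enhancement.

    Hence the boundary map is order-preserving because [<_L] and [<_R] are
    transitive.  For order-reflection, suppose that [(l, r) <= (l', r')] and
    change the two boundaries one at a time.  The only danger is that the
    intermediate pair bounds no vertex, but this cannot happen for both
    [(l, r')] and [(l', r)]: take a vertex between [l] and [r] and a vertex
    between [l'] and [r'].  If the second is the larger one, it lies between [l]
    and [r']; otherwise the first lies between [l'] and [r] ([span_crossed]). *)

Set Implicit Arguments.
Unset Strict Implicit.
Unset Printing Implicit Defensive.

Import Order.TTheory GRing.Theory Num.Theory.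

Local Open Scope classical_set_scope.
Local Open Scope ring_scope.

Ltac arith := unfold vertex, arrow, boundary in *; lia.

(** * Walks and the two sides of an arrow *)

Lemma arrows_ofE (w : quiver) (A : set vertex) (e : arrow) :
  arrows_of w A e <-> A e /\ A (e + 1).
Proof. by rewrite /arrows_of /src /tgt /=; case: (w e); split=> -[]. Qed.

(** A walk passes from one side of an arrow to the other only through it. *)
Lemma linked_same_side (w : quiver) (E : set arrow) (z : arrow) (x y : vertex) :
  ~ E z -> linked w E x y -> (x <= z) = (y <= z).
Proof.
move=> nEz; elim=> {x y} [x y [e Ee]| //|x y t _ -> _ ->//].
have ez : e <> z by move=> ez; apply: nEz; rewrite -ez.
rewrite /src /tgt.
by case: (w e) => -[[<- <-]|[<- <-]]; arith.
Qed.

Lemma linked_sym (w : quiver) (E : set arrow) (x y : vertex) :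
  linked w E x y -> linked w E y x.
Proof.
elim=> {x y} [x y [e Ee h]|x|x y z _ xy _ yz].
- by apply: rt_step; exists e => //; case: h => h; [right|left].
- exact: rt_refl.
- exact: rt_trans yz xy.
Qed.

Lemma linked_interval (w : quiver) (E : set arrow) (x y : vertex) :
  x <= y -> (forall z : arrow, x <= z < y -> E z) -> linked w E x y.
Proof.
move=> xy; have [n ->] : exists n : nat, y = x + n%:Z.
  by exists `|y - x|%N; arith.
elim: n => [|n IHn] En; first by rewrite addr0; exact: rt_refl.
apply: (rt_trans _ _ _ (x + n%:Z)).
  by apply: IHn => z xzn; apply: En; arith.
apply: rt_step; exists (x + n%:Z).
  by apply: En; arith.
have -> : x + n.+1%:Z = x + n%:Z + 1 by arith.
by rewrite /src /tgt; case: (w _); [left|right].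
Qed.

Lemma linked_cut (w : quiver) (e : arrow) (x y : vertex) :
  linked w (~` [set e]) x y <-> (x <= e) = (y <= e).
Proof.
split; first by apply: linked_same_side => /(_ erefl).
wlog xy : x y / x <= y.
  move=> th xyE; have [xy|/ltW yx] := leP x y; first exact: th.
  by apply: linked_sym; apply: th.
move=> xyE; apply: linked_interval => // z xzy /= ze.
by arith.
Qed.

Lemma behindE (w : quiver) (e : arrow) (x : vertex) :
  behind w e x <-> (if w e then x <= e else e < x).
Proof.
rewrite /behind /= linked_cut /src.
by case: (w e); arith.
Qed.

Lemma in_frontE (w : quiver) (e : arrow) (x : vertex) :
  in_front w e x <-> (if w e then e < x else x <= e).
Proof.
rewrite /in_front /= linked_cut /tgt.
by case: (w e); arith.
Qed.

Lemma arrow_behindE (w : quiver) (e e' : arrow) :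
  arrow_behind w e e' <-> (if w e' then e < e' else e' < e).
Proof.
rewrite /arrow_behind arrows_ofE !behindE.
by case: (w e'); arith.
Qed.

(** * Connected subquivers are intervals *)

Definition above (l : boundary) (x : vertex) : Prop :=
  if l is Some e then e < x else True.
Definition below (r : boundary) (x : vertex) : Prop :=
  if r is Some e then x <= e else True.
Definition span (l r : boundary) : set vertex :=
  [set x | above l x /\ below r x].

Lemma connected_convex (w : quiver) (A : set vertex) (x y z : vertex) :
  connected_full w A -> A x -> A y -> x <= z <= y -> A z.
Proof.
move=> [_ cA] Ax Ay xzy; apply: contrapT => nAz.
have yz : y <> z by move=> yz; apply: nAz; rewrite -yz.
have nEz : ~ arrows_of w A z by rewrite arrows_ofE => -[].
have := linked_same_side nEz (cA _ _ Ax Ay).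
by arith.
Qed.

Lemma span_connected (w : quiver) (l r : boundary) :
  span l r !=set0 -> connected_full w (span l r).
Proof.
move=> lr0; split=> // {lr0} x y; wlog xy : x y / x <= y.
  move=> th Ax Ay; have [xy|/ltW yx] := leP x y; first exact: th.
  by apply: linked_sym; apply: th.
move=> [lx _] [_ ry]; apply: linked_interval => // z xzy.
rewrite arrows_ofE /span /=.
by case: l lx => [l|] /= lx; case: r ry => [r|] /= ry; arith.
Qed.

Lemma exists_least (A : set int) (m x : int) :
  A x -> (forall y : int, A y -> m <= y) ->
  exists2 a : int, A a & forall y : int, A y -> a <= y.
Proof.
move=> Ax mA; have exA y : A y -> `[< A (m + `|y - m|%N%:Z) >].
  by move=> Ay; have := mA _ Ay => my; apply/asboolP; have -> : m + `|y - m|%N%:Z = y by arith.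
have exP : exists n, `[< A (m + n%:Z) >] by exists `|x - m|%N; exact: exA.
case: (ex_minnP exP) => n /asboolP An nmin.
exists (m + n%:Z) => // y Ay.
by have := nmin _ (exA _ Ay); have := mA _ Ay; arith.
Qed.

Lemma left_boundary_exists (w : quiver) (alpha : connsub w) :
  exists l, left_boundary alpha l.
Proof.
have [[m mA]|nb] := pselect (exists m : vertex, forall x, verts alpha x -> m <= x).
  have [[x Ax] _] := connsubP alpha.
  have [a Aa aA] := exists_least Ax mA.
  by exists (Some (a - 1)), a.
by exists None.
Qed.

Lemma right_boundary_exists (w : quiver) (alpha : connsub w) :
  exists r, right_boundary alpha r.
Proof.
have [[m mA]|nb] := pselect (exists m : vertex, forall x, verts alpha x -> x <= m).
  have [[x Ax] _] := connsubP alpha.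
  pose B := [set y : int | verts alpha (- y)].
  have Bx : B (- x) by rewrite /B /= opprK.
  have mB y : B y -> - m <= y by move=> /mA; rewrite lerNl.
  have [a Ba aB] := exists_least Bx mB.
  exists (Some (- a)), (- a); split=> // y Ay.
  by rewrite lerNr; apply: aB; rewrite /B /= opprK.
by exists None.
Qed.

(** Being convex, a connected subquiver contains a vertex as soon as it has
    vertices on both sides of it; each boundary, literal or virtual, provides
    one of the two. *)
Lemma boundaries_span (w : quiver) (alpha : connsub w) (l r : boundary) :
  left_boundary alpha l -> right_boundary alpha r -> verts alpha = span l r.
Proof.
move=> Ll Rr; have cA := connsubP alpha.
have lP x : verts alpha x -> above l x.
  case: l Ll => //= l [m [_ mA ->]] /mA.
  by arith.
have rP x : verts alpha x -> below r x.
  by case: r Rr => //= r [m [_ mA ->]] /mA.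
have lE x : above l x -> exists2 y : vertex, verts alpha y & y <= x.
  case: l Ll {lP} => [l [m [Am _ ->]] mx|nb _].
    by exists m => //; rewrite /above in mx; arith.
  apply: contrapT => nx; apply: nb; exists x => y Ay.
  by rewrite leNgt; apply/negP => yx; apply: nx; exists y => //; exact: ltW.
have rE x : below r x -> exists2 y : vertex, verts alpha y & x <= y.
  case: r Rr {rP} => [r [m [Am _ ->]] mx|nb _]; first by exists m.
  apply: contrapT => nx; apply: nb; exists x => y Ay.
  by rewrite leNgt; apply/negP => yx; apply: nx; exists y => //; exact: ltW.
apply/seteqP; split=> [x Ax|x [/lE[y Ay yx] /rE[z Az xz]]].
  by split; [exact: lP|exact: rP].
by apply: (connected_convex cA Ay Az); rewrite yx.
Qed.

Lemma span_boundaries (w : quiver) (alpha : connsub w) (l r : boundary) :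
  verts alpha = span l r -> left_boundary alpha l /\ right_boundary alpha r.
Proof.
move=> aE; have [[x0 +] _] := connsubP alpha.
rewrite /left_boundary /right_boundary aE /span /above /below /=.
rewrite /vertex /boundary => -[lx rx].
split.
  case: l lx {aE} => [l|] lx.
    exists (l + 1); split; last by arith.
      by case: r rx => [r|]; arith.
    by move=> x [? _]; arith.
  move=> [m mA]; case: r rx mA => [r|] rx mA.
    by have := mA (Num.min (m - 1) r); arith.
  by have := mA (m - 1); arith.
case: r rx {aE} => [r|] rx.
  exists r; split=> //.
    by case: l lx => [l|]; arith.
  by move=> x [].
move=> [m mA]; case: l lx mA => [l|] lx mA.
  by have := mA (Num.max (m + 1) (l + 1)); arith.
by have := mA (m + 1); arith.
Qed.

Lemma boundariesP (w : quiver) (alpha : connsub w) (l r : boundary) :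
  left_boundary alpha l /\ right_boundary alpha r <-> verts alpha = span l r.
Proof.
split; [by move=> [Ll Rr]; exact: boundaries_span|exact: span_boundaries].
Qed.

Lemma left_boundary_inj (w : quiver) (alpha : connsub w) (l l' : boundary) :
  left_boundary alpha l -> left_boundary alpha l' -> l = l'.
Proof.
case: l l' => [l|] [l'|] //=.
- move=> [m [Am mA ->]] [m' [Am' mA' ->]].
  by congr (Some (_ - _)); apply/le_anti; rewrite mA // mA'.
- by move=> [m [Am mA _]] []; exists m.
- by move=> nb [m [Am mA _]]; case: nb; exists m.
Qed.

Lemma right_boundary_inj (w : quiver) (alpha : connsub w) (r r' : boundary) :
  right_boundary alpha r -> right_boundary alpha r' -> r = r'.
Proof.
case: r r' => [r|] [r'|] //=.
- move=> [m [Am mA ->]] [m' [Am' mA' ->]].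
  by congr Some; apply/le_anti; rewrite mA // mA'.
- by move=> [m [Am mA _]] []; exists m.
- by move=> nb [m [Am mA _]]; case: nb; exists m.
Qed.

Lemma span_inj (w : quiver) (alpha : connsub w) (l r l' r' : boundary) :
  verts alpha = span l r -> verts alpha = span l' r' -> l = l' /\ r = r'.
Proof.
move=> /span_boundaries[Ll Rr] /span_boundaries[Ll' Rr'].
by split; [exact: left_boundary_inj Ll Ll'|exact: right_boundary_inj Rr Rr'].
Qed.

Lemma verts_inj (w : quiver) : injective (@verts w).
Proof.
move=> [A cA] [B cB] /= AB; move: cA cB; rewrite AB => cA cB.
by congr ConnSub; exact: Prop_irrelevance.
Qed.

(** * Moves lower one boundary *)

Lemma ltL_trans (w : quiver) (a b c : boundary) :
  ltL w a b -> ltL w b c -> ltL w a c.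
Proof.
case: a b c => [a|] [b|] [c|] //=; rewrite ?arrow_behindE;
by do ?[match goal with |- context [w ?e] => case: (w e) end]; arith.
Qed.

Lemma ltR_trans (w : quiver) (a b c : boundary) :
  ltR w a b -> ltR w b c -> ltR w a c.
Proof.
case: a b c => [a|] [b|] [c|] //=; rewrite ?arrow_behindE;
by do ?[match goal with |- context [w ?e] => case: (w e) end]; arith.
Qed.

(** A left boundary is lowered either inwards, to an arrow pointing left, or
    outwards, from an arrow pointing right; arrows of opposite directions allow
    both, according to their positions.  These two cases are the boundary
    changes made by reductions and by enhancements. *)
Lemma ltLP (w : quiver) (l l' : boundary) :
  ltL w l l' <->
  (exists e, [/\ l = Some e, w e = false & above l' e]) \/
  (exists e, [/\ l' = Some e, w e = true & above l e]).
Proof.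
split; last first.
  case=> -[e [-> we]]; first case: l' => [l'|]; last case: l => [l|];
  by rewrite /= ?arrow_behindE ?we //; case: (w _); arith.
case: l l' => [l|] [l'|] //=; last 2 first.
- by move=> wl; left; exists l.
- by move=> wl; right; exists l'.
rewrite arrow_behindE; case: (ltgtP l l') => [ll'|l'l|<-]; last first.
- by case: (w l); arith.
- by move=> h; left; exists l; split=> //; case: (w l) (w l') h => -[]; arith.
- by move=> h; right; exists l'; split=> //; case: (w l) (w l') h => -[]; arith.
Qed.

Lemma ltRP (w : quiver) (r r' : boundary) :
  ltR w r r' <->
  (exists e, [/\ r = Some e, w e = true & below r' (e + 1)]) \/
  (exists e, [/\ r' = Some e, w e = false & below r (e + 1)]).
Proof.
split; last first.
  case=> -[e [-> we]]; first case: r' => [r'|]; last case: r => [r|];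
  by rewrite /= ?arrow_behindE ?we //; case: (w _); arith.
case: r r' => [r|] [r'|] //=; last 2 first.
- by move=> wr; left; exists r.
- by move=> wr; right; exists r'.
rewrite arrow_behindE; case: (ltgtP r r') => [rr'|r'r|<-]; last first.
- by case: (w r); arith.
- move=> h; right; exists r'; split; [by []|..|by arith].
  by case: (w r) (w r') h => -[]; arith.
- move=> h; left; exists r; split; [by []|..|by arith].
  by case: (w r) (w r') h => -[]; arith.
Qed.

Lemma span_arrow (w : quiver) (l r : boundary) (e : arrow) :
  arrows_of w (span l r) e <-> above l e /\ below r (e + 1).
Proof.
rewrite arrows_ofE /span /above /below /=.
by case: l => [l|]; case: r => [r|]; arith.
Qed.

Lemma span_cut_left (l r : boundary) (e : arrow) :
  below r (e + 1) -> span l r `&` [set x | x <= e] = span l (Some e).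
Proof.
move=> re; apply/seteqP; split=> x; rewrite /span /=; first by case=> -[].
by case: r re => [r|] /=; case: l => [l|] /=; arith.
Qed.

Lemma span_cut_right (l r : boundary) (e : arrow) :
  above l e -> span l r `&` [set x | e < x] = span (Some e) r.
Proof.
move=> le; apply/seteqP; split=> x; rewrite /span /=; first by case=> -[].
by case: r => [r|] /=; case: l le => [l|] /=; arith.
Qed.

Lemma span_behind (w : quiver) (l r : boundary) (e : arrow) :
  arrows_of w (span l r) e ->
  span l r `&` behind w e = if w e then span l (Some e) else span (Some e) r.
Proof.
move=> /span_arrow[le re].
have -> : behind w e = if w e then [set x | x <= e] else [set x | e < x].
  by apply/seteqP; split=> x; rewrite behindE; case: (w e).
by case: (w e); [exact: span_cut_left|exact: span_cut_right].
Qed.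

Lemma span_in_front (w : quiver) (l r : boundary) (e : arrow) :
  arrows_of w (span l r) e ->
  span l r `&` in_front w e = if w e then span (Some e) r else span l (Some e).
Proof.
move=> /span_arrow[le re].
have -> : in_front w e = if w e then [set x | e < x] else [set x | x <= e].
  by apply/seteqP; split=> x; rewrite in_frontE; case: (w e).
by case: (w e); [exact: span_cut_right|exact: span_cut_left].
Qed.

Lemma verts_above (w : quiver) (alpha : connsub w) (l : boundary) (e : arrow) :
  verts alpha = span l (Some e) -> above l e.
Proof.
move=> aE; have [[x +] _] := connsubP alpha.
by rewrite aE /span /=; case: l {aE} => [l|] [] //=; arith.
Qed.

Lemma verts_below (w : quiver) (alpha : connsub w) (r : boundary) (e : arrow) :
  verts alpha = span (Some e) r -> below r (e + 1).
Proof.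
move=> aE; have [[x +] _] := connsubP alpha.
by rewrite aE /span /=; case: r {aE} => [r|] [] //=; arith.
Qed.

(** Reductions account for the first case of [ltLP] and of [ltRP], and
    enhancements for the second one.  In the converse direction, the arrow at
    which to cut must belong to the larger interval: on its far side this holds
    because the smaller interval has a vertex. *)
Lemma moveP (w : quiver) (alpha beta : connsub w) (l r l' r' : boundary) :
  verts alpha = span l' r' -> verts beta = span l r ->
  move alpha beta <-> (ltL w l l' /\ r = r') \/ (l = l' /\ ltR w r r').
Proof.
move=> aE bE; split.
  case=> -[e].
    rewrite aE => eP; have /span_arrow[le re] := eP; rewrite (span_behind eP).
    case we: (w e) => /(span_inj bE)[-> ->]; [right|left]; split=> //.
      by apply/ltRP; left; exists e.
    by apply/ltLP; left; exists e.
  rewrite bE => eP; have /span_arrow[le re] := eP; rewrite (span_in_front eP).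
  case we: (w e) => /(span_inj aE)[-> ->]; [left|right]; split=> //.
    by apply/ltLP; right; exists e.
  by apply/ltRP; right; exists e.
case=> [[/ltLP[] [e [E we le]] rE]|[lE /ltRP[] [e [E we re]]]]; subst.
- have eP : arrows_of w (span l' r') e.
    by apply/span_arrow; split=> //; exact: verts_below bE.
  by left; exists e; rewrite aE // bE (span_behind eP) we.
- have eP : arrows_of w (span l r') e.
    by apply/span_arrow; split=> //; exact: verts_below aE.
  by right; exists e; rewrite bE // aE (span_in_front eP) we.
- have eP : arrows_of w (span l' r') e.
    by apply/span_arrow; split=> //; exact: verts_above bE.
  by left; exists e; rewrite aE // bE (span_behind eP) we.
- have eP : arrows_of w (span l' r) e.
    by apply/span_arrow; split=> //; exact: verts_above aE.
  by right; exists e; rewrite bE // aE (span_in_front eP) we.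
Qed.

(** * The embedding *)

Lemma span_crossed (l r l' r' : boundary) :
  span l r !=set0 -> span l' r' !=set0 ->
  span l r' !=set0 \/ span l' r !=set0.
Proof.
move=> [x [lx rx]] [y [ly ry]].
have [xy|/ltW yx] := leP x y.
  left; exists y; split=> //.
  by case: l lx => [l|] //=; arith.
right; exists x; split=> //.
by case: l' ly => [l'|] //=; arith.
Qed.

Lemma re_le_trans (w : quiver) (alpha beta gamma : connsub w) :
  re_le alpha beta -> re_le beta gamma -> re_le alpha gamma.
Proof.
move=> [->//|ab] [<-|bc]; right => //; exact: t_trans bc ab.
Qed.

Lemma re_le_left (w : quiver) (alpha beta : connsub w) (l l' r : boundary) :
  verts alpha = span l r -> verts beta = span l' r -> leL w l l' ->
  re_le alpha beta.
Proof.
move=> aE bE [ll'|ll']; first by left; apply: verts_inj; rewrite aE bE ll'.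
by right; apply: t_step; apply/(moveP bE aE); left.
Qed.

Lemma re_le_right (w : quiver) (alpha beta : connsub w) (l r r' : boundary) :
  verts alpha = span l r -> verts beta = span l r' -> leR w r r' ->
  re_le alpha beta.
Proof.
move=> aE bE [rr'|rr']; first by left; apply: verts_inj; rewrite aE bE rr'.
by right; apply: t_step; apply/(moveP bE aE); right.
Qed.

(** Lowering first the boundary whose change leaves a nonempty interval makes
    each of the two steps a single move. *)
Lemma re_le_span (w : quiver) (alpha beta : connsub w) (l r l' r' : boundary) :
  verts alpha = span l r -> verts beta = span l' r' ->
  leLR w (l, r) (l', r') -> re_le alpha beta.
Proof.
move=> aE bE [/= ll' rr'].
have [a0 _] := connsubP alpha; have [b0 _] := connsubP beta.
rewrite aE in a0; rewrite bE in b0.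
have [g0|g0] := span_crossed a0 b0.
  pose gamma := ConnSub (span_connected w g0).
  apply: (@re_le_trans _ _ gamma); first exact: re_le_right aE _ rr'.
  exact: re_le_left bE ll'.
pose gamma := ConnSub (span_connected w g0).
apply: (@re_le_trans _ _ gamma); first exact: re_le_left aE _ ll'.
exact: re_le_right bE rr'.
Qed.

Lemma leL_trans (w : quiver) (a b c : boundary) :
  leL w a b -> leL w b c -> leL w a c.
Proof. by move=> [->//|ab] [<-|bc]; right => //; exact: ltL_trans ab bc. Qed.

Lemma leR_trans (w : quiver) (a b c : boundary) :
  leR w a b -> leR w b c -> leR w a c.
Proof. by move=> [->//|ab] [<-|bc]; right => //; exact: ltR_trans ab bc. Qed.

Theorem lemma6p1 (w : quiver) (hw : eventually_outward w) :
  exists iota : connsub w -> boundary * boundary,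
    (forall alpha : connsub w,
       left_boundary alpha (iota alpha).1 /\
       right_boundary alpha (iota alpha).2) /\
    order_embedding (@re_le w) (leLR w) iota.
Proof.
have /choice[iota iotaP] : forall alpha : connsub w,
    exists b : boundary * boundary,
      left_boundary alpha b.1 /\ right_boundary alpha b.2.
  move=> alpha; have [l Ll] := left_boundary_exists alpha.
  by have [r Rr] := right_boundary_exists alpha; exists (l, r).
have iotaE alpha : verts alpha = span (iota alpha).1 (iota alpha).2.
  exact/boundariesP.
exists iota; split=> //; split.
- move=> alpha beta [->|]; first by split; left.
  elim=> {alpha beta} [beta alpha /(moveP (iotaE _) (iotaE _))|].
    by case=> -[h1 h2]; split; by [left|right].
  move=> gamma beta alpha _ [gl gr] _ [bl br].
  by split; [exact: leL_trans bl gl|exact: leR_trans br gr].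
- by move=> alpha beta E; apply: verts_inj; rewrite !iotaE E.
- move=> alpha beta; rewrite (surjective_pairing (iota alpha)).
  by rewrite (surjective_pairing (iota beta)); exact: re_le_span.
Qed.
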